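(* Let $d\ge2$, let $2\le n_1<n_2<\dots<n_d$ be integers, let $\mathcal{D}\subset\prod_{j=1}^d\{0,1,\dots,n_j-1\}$ be non-empty, and let $E=K(\{n_j\}_{j=1}^d,\mathcal{D})$ be the associated self-affine Sierpiński sponge. Assume $E$ is non-degenerated. Then $E$ is perfectly disconnected if and only if $E$ and all the projections $\pi_j(E)$, $1\le j\le d-1$, are totally disconnected.
   Context: Self-affine Sierpiński sponge: let $\Lambda=\operatorname{diag}(n_1,\dots,n_d)$ and $S_{\mathbf{i}}(z)=\Lambda^{-1}(z+\mathbf{i})$ for $\mathbf{i}\in\mathcal{D}$, $z\in\mathbb{R}^d$. $E=K(\{n_j\}_{j=1}^d,\mathcal{D})$ is the unique non-empty compact set with $E=\bigcup_{\mathbf{i}\in\mathcal{D}}S_{\mathbf{i}}(E)$; it carries the Euclidean metric. $E$ is degenerated if it is contained in a $(d-1)$-dimensional face of $[0,1]^d$, and non-degenerated otherwise. Projections: $\pi_j(x_1,\dots,x_d)=(x_1,\dots,x_j)$ for $1\le j\le d-1$. $\delta$-connected components: for a metric space $(X,\rho)$ and $\delta>0$, two points $x,y\in X$ are $\delta$-equivalent if there is a finite sequence $x=x_1,x_2,\dots,x_k=y$ in $X$ with $\rho(x_i,x_{i+1})\le\delta$ for $1\le i\le k-1$. An equivalence class is called a $\delta$-connected component of $X$. Perfectly disconnected: a compact metric space $X$ is perfectly disconnected if there is a constant $M_0>0$ such that for every $\delta$ with $0<\delta<\operatorname{diam}(X)$ and every $\delta$-connected component $U$ of $X$, $\operatorname{diam}U\le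 M_0\delta$. *)

(* Defs.v *)
From mathcomp Require Import all_boot all_order all_algebra.
From mathcomp Require Import all_classical all_reals all_analysis.

Set Implicit Arguments.
Unset Strict Implicit.
Unset Printing Implicit Defensive.

Import Order.TTheory GRing.Theory Num.Theory.
Import numFieldNormedType.Exports.

Local Open Scope classical_set_scope.
Local Open Scope ring_scope.

(* A metric space is a set X in a type T together with a distance rho on T,
   because the metric attached to the library's topology on row vectors is the
   sup metric and not the Euclidean one. *)
Section metric.
Variables (R : realType) (T : eqType) (rho : T -> T -> R).

(* Extended-real valued, so that unbounded sets get +oo. *)
Definition diam (A : set T) : \bar R :=
  ereal_sup [set (rho p.1 p.2)%:E | p in A `*` A].

(* The sequence is x :: s. *)
Definition delta_equiv (X : set T) (delta : R) (x y : T) : Prop :=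
  exists s : seq T,
    [/\ [set` x :: s] `<=` X,
        path (fun u v => rho u v <= delta) x s & last x s = y].

Definition delta_component (X : set T) (delta : R) (U : set T) : Prop :=
  exists2 x, X x & U = [set y | delta_equiv X delta x y].

Definition perfectly_disconnected (X : set T) : Prop :=
  exists2 M0 : R, 0 < M0 &
    forall delta : R, 0 < delta -> (delta%:E < diam X)%E ->
    forall U : set T, delta_component X delta U ->
      (diam U <= (M0 * delta)%:E)%E.

End metric.

Section sponge.
Variables (R : realType) (d : nat).

(* The topology that this metric induces on 'rV[R]_d is the library's. *)
Definition euclidean_dist (x y : 'rV[R]_d) : R :=
  Num.sqrt (\sum_(j < d) (x 0 j - y 0 j) ^+ 2).

Section digits.
Variable n : 'I_d -> nat.

Definition digit : finType := {dffun forall j : 'I_d, 'I_(n j)}.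

Definition digit_vector (i : digit) : 'rV[R]_d :=
  \row_j (nat_of_ord (i j))%:R.

Definition Lambda : 'M[R]_d := diag_mx (\row_j (n j)%:R).

(* Points are row vectors, so the symmetric matrix Lambda^-1 acts on the
   right. *)
Definition sponge_map (i : digit) (z : 'rV[R]_d) : 'rV[R]_d :=
  (z + digit_vector i) *m invmx Lambda.

(* By Hutchinson's theorem exactly one set E satisfies this when D is non-empty
   and every n j is at least 2. *)
Definition is_sponge (D : {set digit}) (E : set 'rV[R]_d) : Prop :=
  [/\ E !=set0, compact E & E = \bigcup_(i in [set` D]) (sponge_map i @` E)].

End digits.

Definition unit_cube : set 'rV[R]_d := [set x | forall j, 0 <= x 0 j <= 1].

(* The (d-1)-dimensional faces of the cube: one coordinate is fixed to 0
   (b = false) or 1 (b = true). *)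
Definition cube_facet (j : 'I_d) (b : bool) : set 'rV[R]_d :=
  unit_cube `&` [set x | x 0 j = b%:R].

Definition degenerated (E : set 'rV[R]_d) : Prop :=
  exists (j : 'I_d) (b : bool), E `<=` cube_facet j b.

Definition coord_proj (j : 'I_d) (x : 'rV[R]_d) : 'rV[R]_j :=
  \row_(k < j) x 0 (widen_ord (ltnW (ltn_ord j)) k).

End sponge.

(* Main.v *)
(* If pi_k(E) contains a connected set through a and b with a_i <> b_i, i <= k,
   then a and b are joined in E by chains whose first k coordinates move
   arbitrarily slowly. The l-th iterate of one map S_i turns such a chain into a
   C n_(k+1)^-l-chain of E whose end points are c n_i^-l apart, which is
   incompatible with perfect disconnectedness as n_i < n_(k+1).

   Conversely, a compact totally disconnected set has arbitrarily small
   h-components as h -> 0, and this property is inherited by a finite union of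
   integer translates of pi_k(E). Given a delta-chain in E, choose l with
   delta n_k^l comparable to a small constant: Lambda^l maps the chain, seen in
   its first k coordinates, into such a union with small steps, because
   n_i <= n_k for i <= k. So the k-th coordinate moves by at most n_k^-l, which
   is comparable to delta. *)

Require Import Defs.
From mathcomp Require Import all_boot all_order all_algebra.
From mathcomp Require Import all_classical all_reals all_analysis.
From mathcomp Require Import lra ring zify.

Import Order.TTheory GRing.Theory Num.Theory.
Import numFieldNormedType.Exports.

Local Open Scope classical_set_scope.
Local Open Scope ring_scope.

Set Implicit Arguments.
Unset Strict Implicit.
Unset Printing Implicit Defensive.

(** * Chains in a set *)

(** Chains grow at the far end, so induction keeps the start [x] fixed and carries an invariant of
    the current point. *)
Inductive chain (T : Type) (X : set T) (r : T -> T -> Prop) (x : T) :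
    T -> Prop :=
| chain_nil : X x -> chain X r x x
| chain_rcons y z : chain X r x y -> X z -> r y z -> chain X r x z.

Section chains.
Variables (T : Type) (X : set T).
Implicit Types r : T -> T -> Prop.

Lemma chain_src r x y : chain X r x y -> X x.
Proof. by elim. Qed.

Lemma chain_tgt r x y : chain X r x y -> X y.
Proof. by elim. Qed.

Lemma chain_trans r x y z : chain X r x y -> chain X r y z -> chain X r x z.
Proof. by move=> xy; elim=> // u v _ xu; exact: chain_rcons. Qed.

Lemma chain_sym r x y :
  (forall u v, r u v -> r v u) -> chain X r x y -> chain X r y x.
Proof.
move=> rC; elim=> [|u v xu ux Xv uv]; first exact: chain_nil.
apply: chain_trans ux; apply: chain_rcons (chain_nil _ Xv) (chain_tgt xu) _.
exact: rC.
Qed.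

Lemma chain_map (U : Type) (Y : set U) (f : T -> U) r
    (r' : U -> U -> Prop) x y :
  (forall u, X u -> Y (f u)) ->
  (forall u v, X u -> X v -> r u v -> r' (f u) (f v)) ->
  chain X r x y -> chain Y r' (f x) (f y).
Proof.
move=> XY rr'; elim=> [Xx|u v xu fxu Xv uv]; first exact/chain_nil/XY.
by apply: chain_rcons fxu (XY _ Xv) _; apply: rr' => //; exact: chain_tgt xu.
Qed.

Lemma sub_chain r r' x y :
  (forall u v, r u v -> r' u v) -> chain X r x y -> chain X r' x y.
Proof. by move=> rr'; apply: (@chain_map _ _ id) => // u v _ _; exact: rr'. Qed.

End chains.

(** Any choice of preimages works, since [r] between two points follows from [r'] between their
    images. The end point is prescribed, so the induction ranges over all preimages. *)
Lemma chain_lift (T U : Type) (X : set T) (f : T -> U) (r : T -> T -> Prop)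
    (r' : U -> U -> Prop) x y :
  (forall u, r' u u) -> (forall u v, r' (f u) (f v) -> r u v) ->
  X x -> X y -> chain (f @` X) r' (f x) (f y) -> chain X r x y.
Proof.
move=> r'xx r'r Xx Xy fxy.
suff lift z : chain (f @` X) r' (f x) z ->
    forall t, X t -> f t = z -> chain X r x t by exact: lift fxy y Xy erefl.
elim=> [_ t Xt ftx|u v xu IHu _ uv t Xt ftv].
  by apply: chain_rcons (chain_nil _ Xx) Xt _; apply: r'r; rewrite ftx.
have [w Xw fwu] := chain_tgt xu.
by apply: chain_rcons (IHu w Xw fwu) Xt _; apply: r'r; rewrite fwu ftv.
Qed.

Lemma delta_equivP (R : realType) (T : eqType) (rho : T -> T -> R)
    (X : set T) delta x y :
  delta_equiv rho X delta x y <-> chain X (fun u v => rho u v <= delta) x y.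
Proof.
split=> [[s []]|].
  elim: s x => [|z s IHs] x /= sX; first by move=> _ <-;
    exact/chain_nil/sX/mem_head.
  case/andP=> xz zs sy; apply: (@chain_trans _ _ _ _ z); last first.
    by apply: IHs => // t zt; apply: sX; rewrite /= in_cons zt orbT.
  apply: (@chain_rcons _ _ _ _ x) => //.
    by apply/chain_nil/sX; rewrite /= mem_head.
  by apply: sX; rewrite /= !in_cons eqxx orbT.
elim=> [Xx|u v _ [s [sX xs su]] Xv uv].
  by exists [::]; split => // t /=; rewrite inE => /eqP ->.
exists (rcons s v); split; last by rewrite last_rcons.
  move=> t /=; rewrite -rcons_cons mem_rcons in_cons => /orP[/eqP -> //|st].
  exact: sX.
by rewrite rcons_path xs su.
Qed.

(** * Fine chains and connectedness in compact spaces *)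

Section compact_chains.
Variables (R : realType) (T : pseudoMetricType R).
Implicit Types (X : set T) (x y p : T) (h e s : R).

(** Monotonicity in [h] makes the sets of [x] in [X] with [Q h x] a proper filter base; [p] is a
    cluster point of it. *)
Lemma compact_accumulation X (Q : R -> T -> Prop) : compact X ->
  (forall h h' x, h <= h' -> Q h x -> Q h' x) ->
  (forall h, 0 < h -> exists2 x, X x & Q h x) ->
  exists2 p, X p &
    forall h s, 0 < h -> 0 < s -> exists x, [/\ X x, Q h x & ball p s x].
Proof.
move=> cX Qmono QX.
pose B h := [set x | X x /\ Q h x].
have FF : ProperFilter (filter_from [set h | 0 < h] B).
  apply: filter_from_proper => [|h /= /QX[x Xx Qx]]; last by exists x.
  apply: filter_from_filter; first by exists 1 => /=.
  move=> h h' /= h0 h'0; exists (Num.min h h'); first by rewrite /= lt_min h0.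
  move=> x [Xx Qx].
  by split; split => //; apply: Qmono Qx; rewrite ge_min lexx ?orbT.
have [|p [Xp pF]] := cX _ FF; first by exists 1 => //= x [].
exists p => // h s h0 s0.
have Bh : filter_from [set h | 0 < h] B (B h) by exists h.
by have [x [[Xx Qx] px]] := pF _ _ Bh (nbhsx_ballx p _ s0); exists x.
Qed.

Lemma chain_ball_le X h h' x y :
  h <= h' -> chain X (fun u => ball u h) x y -> chain X (fun u =>
    ball u h') x y.
Proof. by move=> hh'; apply: sub_chain => u v; exact: le_ball. Qed.

(** For [x] in a compact [X] this is the classical quasi-component, the intersection of all
    relatively clopen sets containing [x]. *)
Let quasicomponent X x := [set y | forall h, 0 < h -> chain X (fun u =>
  ball u h) x y].

(** End points in [C] of ever finer chains accumulate at a point of [C], which one further step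
    joins to [x]. *)
Lemma quasicomponent_meets X x C : compact X -> closed C ->
  (forall h, 0 < h -> exists2 y, C y & chain X (fun u => ball u h) x y) ->
  quasicomponent X x `&` C !=set0.
Proof.
move=> cX clC meet.
pose Q h y := C y /\ chain X (fun u => ball u h) x y.
have [||p Xp pQ] := @compact_accumulation X Q cX.
- by move=> h h' y hh' [Cy xy]; split => //; exact: chain_ball_le xy.
- by move=> h /meet[y Cy xy]; exists y => //; exact: chain_tgt xy.
exists p; split=> [h h0|].
  have [y [_ [_ xy] py]] := pQ _ _ h0 h0.
  by apply: chain_rcons xy Xp _; exact: ball_sym.
apply: clC => O /nbhs_ballP[s s0 psO].
by have [y [_ [Cy _] py]] := pQ _ _ s0 s0; exists y; split => //; exact: psO.
Qed.

(** A relatively clopen part [B] of [K] keeps a positive distance [r] from the rest of [K]. Chains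
    too fine to jump over this gap would leave a point of [K] in it. *)
Lemma quasicomponent_connected X x : compact X ->
  connected (quasicomponent X x).
Proof.
move=> cX; set K := quasicomponent X x.
have KX y : K y -> X y by move=> Ky; exact: chain_tgt (Ky 1 ltr01).
move=> B [b Bb] [V opV BV] [C clC BC].
have BK : B `<=` K by rewrite BV; exact: subIsetl.
(* Otherwise points of [B] with ever closer points of [K] outside [B] accumulate at some [p] in [B];
   but [V] is a neighbourhood of [p] and meets [K] only in [B]. *)
have [r r0 Br] : exists2 r, 0 < r & forall u v, B u -> K v -> ball u r v -> B v.
  apply: contrapT => nr.
  pose Q h u := B u /\ exists v, [/\ K v, ball u h v & ~ B v].
  have [||p Xp pQ] := @compact_accumulation X Q cX.
  - move=> h h' u hh' [Bu [v [Kv uv nBv]]]; split=> //; exists v; split=> //.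
    exact: le_ball uv.
  - move=> h h0; apply: contrapT => nh; apply: nr; exists h => // u v Bu Kv uv.
    apply: contrapT => nBv; apply: nh; exists u; first exact/KX/BK.
    by split=> //; exists v.
  have Bp : B p.
    rewrite BC; split.
      move=> h h0; have [u [_ [Bu _] pu]] := pQ _ _ h0 h0.
      by apply: chain_rcons (BK _ Bu _ h0) Xp _; exact: ball_sym.
    apply: clC => W /nbhs_ballP[s s0 psW].
    have [u [_ [Bu _] pu]] := pQ _ _ s0 s0; exists u; split; last exact: psW.
    by move: Bu; rewrite BC => -[].
  have /nbhs_ballP[s s0 psV] : nbhs p V.
    by apply: open_nbhs_nbhs; split => //; move: Bp; rewrite BV => -[].
  have s20 : 0 < s / 2 by rewrite divr_gt0.
  have [u [_ [_ [v [Kv uv nBv]]] pu]] := pQ _ _ s20 s20; apply: nBv.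
  by rewrite BV; split => //; apply: psV; exact: ball_split pu uv.
rewrite predeqE => z; split=> [/BK//|Kz].
pose N s := \bigcup_(a in B) ball a s.
have Kb y : K y -> forall h, 0 < h -> chain X (fun u => ball u h) b y.
  move=> Ky h h0; apply: chain_trans (Ky _ h0).
  by apply: chain_sym (BK _ Bb _ h0) => u v; exact: ball_sym.
(* Small chains from b cannot leave N (r / 4): they would have to visit the
   closed shell below, which does not meet K. *)
pose W := closure (N (r / 2)) `&` ~` interior (N (r / 4)).
have r40 : 0 < r / 4 by rewrite divr_gt0.
have r20 : 0 < r / 2 by rewrite divr_gt0.
have [h h0 hW] : exists2 h, 0 < h &
    forall y, chain X (fun u => ball u h) b y -> ~ W y.
  apply: contrapT => nh.
  have clW : closed W.
    apply: closedI; first exact: closed_closure.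
    exact/open_closedC/open_interior.
  have [|p [bp [pN2 pN4]]] := @quasicomponent_meets X b W cX clW.
    move=> h h0; apply: contrapT => nhW; apply: nh; exists h => // y xy Wy.
    by apply: nhW; exists y.
  have Kp : K p by move=> h h0; apply: chain_trans (BK _ Bb _ h0) (bp _ h0).
  (* [p] is within [r] of [B], so it lies in [B], whereas the shell excludes the interior of
     [N (r / 4)]. *)
  have [v [[a Ba av] pv]] := pN2 _ (nbhsx_ballx p _ r20).
  have Bp : B p by apply: Br Ba Kp _; apply: ball_split av _; exact: ball_sym.
  apply: pN4; apply/nbhs_ballP; exists (r / 4) => // w pw; exists p => //.
have h'0 : 0 < Num.min h (r / 4) by rewrite lt_min h0.
have [a Ba az] : N (r / 4) z.
  (* The first point outside [N (r / 4)] would still lie in [N (r / 2)], hence in the shell. *)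
  elim: (Kb _ Kz _ h'0) => [_|u v bu [a Ba au] Xv uv].
    by exists b => //; exact: ballxx.
  apply: interior_subset; apply: contrapT => vN; apply: (hW v).
    apply: (@chain_ball_le _ (Num.min h (r / 4))); first by rewrite ge_min lexx.
    exact: chain_rcons bu Xv uv.
  split=> //; apply: subset_closure; exists a => //.
  have -> : r / 2 = r / 4 + r / 4 by lra.
  by apply: ball_triangle au _; apply: le_ball uv; rewrite ge_min lexx orbT.
by apply: Br Ba Kz _; apply: le_ball az; lra.
Qed.

(** Quasi-components are connected, hence points, so fine chains from a given start stay close to
    it. Compactness makes this uniform in the start. *)
Lemma totally_disconnected_chain X : compact X -> totally_disconnected X ->
  forall e, 0 < e -> exists2 h, 0 < h &
    forall x y, chain X (fun u => ball u h) x y -> ball x e y.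
Proof.
move=> cX tdX e e0.
have pointwise x : X x -> forall s, 0 < s -> exists2 h, 0 < h &
    forall y, chain X (fun u => ball u h) x y -> ball x s y.
  move=> Xx s s0; apply: contrapT => nh.
  have [||y [xy /=]] := @quasicomponent_meets X x (~` interior (ball x s)) cX.
  - exact/open_closedC/open_interior.
  - move=> h h0; apply: contrapT => nhC; apply: nh; exists h => // y xy.
    apply: contrapT => nxy; apply: nhC; exists y => //= ixy.
    by apply: nxy; exact: interior_subset.
  have xx : quasicomponent X x x by move=> h h0; exact: chain_nil.
  have sX : quasicomponent X x `<=` X by move=> z Kz;
    exact: chain_tgt (Kz 1 ltr01).
  have := connected_component_max xx sX (quasicomponent_connected cX) xy.
  by rewrite tdX //= => ->; apply; exact: nbhsx_ballx.
apply: contrapT => nh.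
pose Q h x := exists2 y, chain X (fun u => ball u h) x y & ~ ball x e y.
have [||p Xp pQ] := @compact_accumulation X Q cX.
- by move=> h h' x hh' [y xy nxy]; exists y => //; exact: chain_ball_le xy.
- move=> h h0; apply: contrapT => nhX; apply: nh; exists h => // x y xy.
  apply: contrapT => nxy; apply: nhX; exists x; first exact: chain_src xy.
  by exists y.
(* Bad starts accumulate at [p]; a chain from [p] through [x] to [y] keeps both within [e / 2] of
   [p]. *)
have e20 : 0 < e / 2 by rewrite divr_gt0.
have [h h0 ph] := pointwise p Xp _ e20.
have [x [Xx [y xy nxy] px]] := pQ _ _ h0 h0; apply: nxy.
have px' : chain X (fun u => ball u h) p x :=
  chain_rcons (chain_nil _ Xp) Xx px.
apply: ball_split (ball_sym (ph _ px')) (ph _ _); exact: chain_trans px' xy.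
Qed.

(** The points reachable from [x] form a relatively open and closed set. *)
Lemma connected_chain X x y h : connected X -> 0 < h -> X x -> X y ->
  chain X (fun u => ball u h) x y.
Proof.
move=> conX h0 Xx Xy; pose B := [set z | chain X (fun u => ball u h) x z].
suff BX : B = X by have : B y by rewrite BX.
apply: conX.
- by exists x; exact: chain_nil.
- exists (\bigcup_(z in B) interior (ball z h)).
    by apply: bigcup_open => z _; exact: open_interior.
  rewrite predeqE => z; split=> [xz|[Xz [w xw wz]]].
    by split; [exact: chain_tgt xz|exists z => //; exact: nbhsx_ballx].
  by apply: chain_rcons xw Xz _; exact: interior_subset.
- exists (closure B); first exact: closed_closure.
  rewrite predeqE => z; split=> [xz|[Xz clz]].
    by split; [exact: chain_tgt xz|exact: subset_closure].
  have [w [xw zw]] := clz _ (nbhsx_ballx z _ h0).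
  by apply: chain_rcons xw Xz _; exact: ball_sym.
Qed.

End compact_chains.

(** * Chains seen in the first coordinates, unions and translates *)

Section coord_close.
Variables (R : realType) (d : nat).
Implicit Types (x y z : 'rV[R]_d) (X A B : set 'rV[R]_d) (k : nat) (h e : R).

(** Closeness of projections without leaving the ambient space; [k] is a plain number, so [k = d]
    covers all coordinates. *)
Definition coord_close k h x y := forall i : 'I_d, (i < k)%N ->
  `|x 0 i - y 0 i| <= h.

Lemma coord_close_sym k h x y : coord_close k h x y -> coord_close k h y x.
Proof. by move=> xy i ik; rewrite distrC; exact: xy. Qed.

Lemma coord_close_triangle k h h' x y z :
  coord_close k h x y -> coord_close k h' y z -> coord_close k (h + h') x z.
Proof.
move=> xy yz i ik; apply: le_trans (ler_distD (y 0 i) _ _) _.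
by apply: lerD; [exact: xy|exact: yz].
Qed.

Lemma coord_close_le k h h' x y : h <= h' -> coord_close k h x y ->
  coord_close k h' x y.
Proof. by move=> hh' xy i ik; exact: le_trans (xy i ik) hh'. Qed.

(** A uniform form of total disconnectedness of the projection of [X], chosen because it passes to
    finite unions. *)
Definition chain_disconnected k X := forall e, 0 < e ->
  exists2 h, 0 < h & forall x y, chain X (coord_close k h) x y ->
    coord_close k e x y.

(** The scales are fixed in the order [hA], [e'], [hB]: excursions into [B] are made short compared
    with the step allowed in [A]. *)
Lemma chain_disconnectedU k A B : chain_disconnected k A ->
  chain_disconnected k B -> chain_disconnected k (A `|` B).
Proof.
move=> cdA cdB e e0.
have [hA hA0 chA] := cdA (e / 8) ltac:(lra).
(* Stepping into [B], moving there and stepping back costs at most [3 * e'], which must fit in one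
   step [hA]. *)
have [e' e'0 [e'h e'e]] : exists2 e', 0 < e' & 4 * e' <= hA /\ e' <= e / 8.
  exists (Num.min (hA / 4) (e / 8)); first by rewrite lt_min; apply/andP;
    split; lra.
  split; last by rewrite ge_min lexx orbT.
  suff : Num.min (hA / 4) (e / 8) <= hA / 4 by lra.
  by rewrite ge_min lexx.
have [hB hB0 chB] := cdB _ e'0.
pose h := Num.min hB e'.
have h0 : 0 < h by rewrite lt_min hB0.
have hhB : h <= hB by rewrite ge_min lexx.
have he' : h <= e' by rewrite ge_min lexx orbT.
(* An excursion into B moves by at most e', so that the points of A before
   and after it are still hA-coord_close. *)
pose reach x y := chain A (coord_close k hA) x y \/ exists a b,
  [/\ chain A (coord_close k hA) x a, coord_close k h a b &
    chain B (coord_close k hB) b y].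
have reachS x y z : reach x y -> (A `|` B) z -> coord_close k h y z ->
  reach x z.
  move=> [xy|[a [b [xa ab by_]]]] [Az|Bz] yz.
  - by left; apply: chain_rcons xy Az _; apply: coord_close_le yz; lra.
  - by right; exists y, z; split => //; exact: chain_nil.
  - left; apply: chain_rcons xa Az _.
    apply: coord_close_le (coord_close_triangle (coord_close_triangle ab (chB _
      _ by_)) yz); lra.
  - right; exists a, b; split => //; apply: chain_rcons by_ Bz _.
    exact: coord_close_le yz.
have reach_close x y : reach x y -> coord_close k (3 * e / 8) x y.
  move=> [/chA|[a [b [/chA xa ab /chB by_]]]]; first by apply: coord_close_le;
    lra.
  apply: coord_close_le (coord_close_triangle (coord_close_triangle xa ab)
    by_); lra.
exists h => // x y xy.
(* [reach] starts in [A]; a chain starting in [B] is cut where it passes to [A]. *)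
have xB_ : reach x y \/ B x /\ (chain B (coord_close k hB) x y \/
    exists b a, [/\ chain B (coord_close k hB) x b, coord_close k h b a &
      reach a y]).
  elim: xy => [[Ax|Bx]|u v xu IH ABv uv].
  - by left; left; exact: chain_nil.
  - by right; split => //; left; exact: chain_nil.
  - case: IH => [xu'|[Bx [xu'|[b [a [xb ba au]]]]]].
    + by left; exact: reachS xu' ABv uv.
    + right; split => //; case: ABv => [Av|Bv].
        by right; exists u, v; split => //; left; exact: chain_nil.
      by left; apply: chain_rcons xu' Bv _; exact: coord_close_le uv.
    + right; split => //; right; exists b, a; split => //.
      exact: reachS au ABv uv.
case: xB_ => [/reach_close|[_ [/chB|[b [a [/chB xb ba /reach_close ay]]]]]].
- by apply: coord_close_le; lra.
- by apply: coord_close_le; lra.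
- apply: coord_close_le (coord_close_triangle (coord_close_triangle xb ba) ay);
  lra.
Qed.

Lemma chain_disconnected_bigcup k (I : finType) (F : I -> set 'rV[R]_d) :
  (forall i, chain_disconnected k (F i)) ->
  chain_disconnected k (\bigcup_i F i).
Proof.
move=> cdF.
have -> : \bigcup_i F i = \big[setU/set0]_(i <- enum I) F i.
  rewrite -bigcup_seq; apply: eq_bigcupl.
  by split => i //= _; rewrite mem_enum.
apply: big_ind => // [e e0|]; last exact: chain_disconnectedU.
by exists 1 => // x y xy; case: (chain_src xy).
Qed.

(* Only the first k coordinates matter, so the translate is saturated in the
   other ones. *)
Definition translate k X (v : 'I_d -> R) : set 'rV[R]_d :=
  [set u | exists2 p, X p & forall i : 'I_d, (i < k)%N -> u 0 i = p 0 i + v i].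

Lemma chain_disconnected_translate k X v :
  chain_disconnected k X -> chain_disconnected k (translate k X v).
Proof.
move=> cdX e e0; have [h h0 ch] := cdX e e0; exists h => // x y xy.
have [p Xp px] := chain_src xy.
suff [q qy pq] : exists2 q : 'rV[R]_d,
    (forall i : 'I_d, (i < k)%N -> y 0 i = q 0 i + v i) &
    chain X (coord_close k h) p q.
  move=> i ik; rewrite px// qy//.
  by have := ch _ _ pq i ik; rewrite opprD addrACA subrr addr0.
elim: xy => [_|u w _ [q qu pq] [q' Xq' q'w] uw].
  by exists p => //; exact: chain_nil.
exists q' => //; apply: chain_rcons pq Xq' _ => i ik.
by have := uw i ik; rewrite qu// q'w// opprD addrACA subrr addr0.
Qed.

End coord_close.

(** * Geometric scales *)

Section scale.
Variables (R : realType).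

Lemma expr_archimedean (a q : R) : 1 < q -> exists l, a < q ^+ l.
Proof.
move=> q1; pose l := Num.Def.archi_bound (`|a| / (q - 1)).
have bernoulli m : 1 + m%:R * (q - 1) <= q ^+ m.
  elim: m => [|m IHm]; first by rewrite mul0r addr0 expr0.
  rewrite exprS -natr1; have q0 : 0 <= q by lra.
  have m0 : 0 <= m%:R :> R by [].
  have := ler_wpM2l q0 IHm; have := mulr_ge0 m0 (sqr_ge0 (q - 1)); nra.
exists l; apply: lt_le_trans (bernoulli l); apply: le_lt_trans (ler_norm a) _.
have : `|a| / (q - 1) < l%:R by apply: archi_boundP; rewrite divr_ge0//; lra.
by rewrite ltr_pdivrMr; lra.
Qed.

Lemma scale_exists (a c : R) m : 0 < a -> a <= c -> (2 <= m)%N ->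
  exists l, a * m%:R ^+ l <= c < a * m%:R ^+ l.+1.
Proof.
move=> a0 ac m2.
have exl : exists l, c < a * m%:R ^+ l.
  have m1 : 1 < m%:R :> R by rewrite ltr1n.
  by have [l] := expr_archimedean (c / a) m1; rewrite ltr_pdivrMr// mulrC;
    exists l.
(* The least such exponent is positive because [a <= c]. *)
case: (ex_minnP exl) => -[|l] cl lmin; first by move: cl;
  rewrite expr0 mulr1 ltNge ac.
exists l; rewrite cl andbT leNgt; apply/negP => /lmin; by rewrite ltnn.
Qed.

End scale.

(** * Rescaling the sponge and bounding each coordinate along chains *)

Section sponge_dynamics.
Variables (R : realType) (d : nat) (n : 'I_d -> nat).
Hypothesis n_ge2 : forall j, (2 <= n j)%N.
Variables (D : {set digit n}) (E : set 'rV[R]_d).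
Hypothesis spongeE : is_sponge D E.

Let n_gt0 j : 0 < (n j)%:R :> R.
Proof. by rewrite ltr0n; exact: leq_trans (n_ge2 j). Qed.

Lemma sponge_mapE (i : digit n) (z : 'rV[R]_d) :
  sponge_map i z = \row_j ((z 0 j + (i j)%:R) / (n j)%:R).
Proof.
have unitL : Lambda R n \in unitmx.
  rewrite unitmxE det_diag unitfE; apply/prodf_neq0 => j _.
  by rewrite mxE gt_eqF.
have := mulmxKV unitL (z + digit_vector R i).
rewrite -/(sponge_map i z) /Lambda mul_mx_diag => eqz.
apply/rowP => j; rewrite mxE; move/rowP/(_ j): eqz; rewrite !mxE => <-.
by rewrite mulfK// gt_eqF.
Qed.

(** [Lambda ^ l] followed by an integer translation; for suitable [v] it inverts a composition of
    [l] maps [sponge_map]. *)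
Definition zoom l (v : 'I_d -> int) (x : 'rV[R]_d) : 'rV[R]_d :=
  \row_j ((n j)%:R ^+ l * x 0 j - (v j)%:~R).

(** One map is undone at a time; [v] collects the digits in base [n j] by Horner's rule. *)
Lemma sponge_zoom l x : E x -> exists v, E (zoom l v x).
Proof.
move=> Ex; elim: l => [|l [v Ev]].
  exists (fun=> 0); suff -> : zoom 0 (fun=> 0) x = x by [].
  by apply/rowP => j; rewrite mxE expr0 mul1r subr0.
case: spongeE => _ _ EE; move: Ev; rewrite [X in X _ -> _]EE =>
  -[i _ [z Ez zx]].
exists (fun j => v j * (n j)%:Z + (i j : nat)%:Z).
suff -> : zoom l.+1 (fun j => v j * (n j)%:Z + (i j : nat)%:Z) x = z by [].
apply/rowP => j; move/rowP/(_ j): zx; rewrite sponge_mapE !mxE => zx.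
have -> : z 0 j = (z 0 j + (i j)%:R) / (n j)%:R * (n j)%:R - (i j)%:R.
  by rewrite divfK ?gt_eqF// addrK.
rewrite zx rmorphD rmorphM /= exprS; ring.
Qed.

(** The [l]-fold iterate of one fixed [sponge_map i]; only its linear part matters, so [c] stays
    anonymous. *)
Lemma sponge_contraction l : D != finset.set0 ->
  exists c : 'rV[R]_d, forall z, E z ->
    E (\row_j (z 0 j / (n j)%:R ^+ l + c 0 j)).
Proof.
move=> /finset.set0Pn[i iD]; elim: l => [|l [c cE]].
  exists 0 => z Ez; suff ->
    : \row_j (z 0 j / (n j)%:R ^+ 0 + (0 : 'rV[R]_d) 0 j) = z by [].
  by apply/rowP => j; rewrite !mxE expr0 divr1 addr0.
exists (\row_j ((c 0 j + (i j)%:R) / (n j)%:R)) => z Ez.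
case: spongeE => _ _ ->; exists i => //;
  exists (\row_j (z 0 j / (n j)%:R ^+ l + c 0 j)).
  exact: cE.
rewrite sponge_mapE; apply/rowP => j; rewrite !mxE exprS; field.
by rewrite expf_neq0 gt_eqF.
Qed.

Lemma sponge_bounded : exists B : nat, forall x i, E x -> `|x 0 i| <= B%:R.
Proof.
case: spongeE => _ cE _.
suff /choice[b bE] : forall i : 'I_d, exists B : nat, forall x, E x ->
  `|x 0 i| <= B%:R.
  exists (\max_i b i)%N => x i Ex; apply: le_trans (bE i x Ex) _.
  by rewrite ler_nat; exact: leq_bigmax.
move=> i.
have /compact_bounded[M [_ ME]] : compact ((fun x : 'rV[R]_d => x 0 i) @` E).
  apply: continuous_compact => //; apply: continuous_subspaceT.
  exact: coord_continuous.
exists (Num.Def.archi_bound (`|M| + 1)) => x Ex.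
apply: le_trans (ME (`|M| + 1) _ _ _) _.
- by apply: le_lt_trans (ler_norm M) _; rewrite ltrDl.
- by exists x.
- by apply/ltW/archi_boundP; rewrite addr_ge0.
Qed.

Hypothesis n_incr : forall i j : 'I_d, (i < j)%N -> (n i < n j)%N.

Lemma sponge_coord_bound (k : 'I_d) : chain_disconnected k.+1 E ->
  exists2 M, 0 < M & forall delta, 0 < delta ->
    forall x y, chain E (coord_close d delta) x y ->
      `|x 0 k - y 0 k| <= M * delta.
Proof.
move=> cdE; have [B EB] := sponge_bounded.
(* [L] is 1 for a displacement along the chain plus [B] for each of two points of [E]. [I] encodes
   the integer vectors with entries in [-L, L], shifted by [L]. *)
pose L := (B + B).+1.
pose I : finType := {ffun 'I_d -> 'I_(L + L).+1}.
pose v (f : I) j : R := (f j)%:R - L%:R.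
pose G := \bigcup_(f : I) translate k.+1 E (v f).
have cdG : chain_disconnected k.+1 G.
  by apply: chain_disconnected_bigcup => f; exact: chain_disconnected_translate.
have [h h0 hG] := cdG (1 / 2) ltac:(lra).
(* [c <= h] keeps the rescaled steps admissible in [G]; [c <= 1 / 2] lets one more step follow a
   move of [1 / 2] within the range 1 of [zoomG]. *)
pose c := Num.min h (1 / 2).
have c0 : 0 < c by rewrite lt_min h0; lra.
have ch : c <= h by rewrite ge_min lexx.
have c2 : c <= 1 / 2 by rewrite ge_min lexx orbT.
have nk0 := n_gt0 k.
exists (((B + B)%:R + (n k)%:R) / c).
  by rewrite divr_gt0// ltr_wpDl.
move=> delta delta0 x y xy.
(* For large [delta] the boundedness of [E] suffices. *)
have [cdelta|deltac] := ltP c delta.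
  have xyB : `|x 0 k - y 0 k| <= (B + B)%:R.
    rewrite natrD; apply: le_trans (ler_normB _ _) _.
    by apply: lerD; apply: EB; [exact: chain_src xy|exact: chain_tgt xy].
  apply: le_trans xyB _; rewrite mulrAC ler_pdivlMr//.
  by apply: ler_pM => //; [exact: ltW|rewrite lerDl ltW|exact: ltW].
have [l /andP[lc cl]] := scale_exists delta0 deltac (n_ge2 k).
have nkl0 : 0 < (n k)%:R ^+ l :> R by rewrite exprn_gt0.
have [v0 Ev0] := sponge_zoom l (chain_src xy).
(* The integer translations occurring near the start of the rescaled chain
   are bounded, because E is. *)
have zoomG u : E u -> coord_close k.+1 1 (zoom l v0 x) (zoom l v0 u) ->
  G (zoom l v0 u).
  move=> Eu xu; have [w Ew] := sponge_zoom l Eu.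
  pose a i : int := w i - v0 i.
  exists [ffun j => inord `|(a j + L%:Z)%R|%N] => //; exists (zoom l w u) =>
    // i ik.
  have aL : `|(a i)%:~R| <= L%:R :> R.
    have -> : (a i)%:~R = (zoom l v0 u 0 i - zoom l v0 x 0 i)
        + zoom l v0 x 0 i - zoom l w u 0 i :> R by rewrite /a rmorphB /= !mxE;
          ring.
    have -> : L%:R = 1 + B%:R + B%:R :> R by rewrite /L -natr1 natrD; ring.
    apply: le_trans (ler_normB _ _) _; apply: lerD; last exact: EB.
    apply: le_trans (ler_normD _ _) _; apply: lerD; last exact: EB.
    by rewrite distrC; exact: xu.
  have {}aL : (`|a i|%R <= L%:Z)%R by rewrite -(ler_int R) intr_norm.
  rewrite /v ffunE inordK; last by lia.
  have -> : (`|(a i + L%:Z)%R|%N)%:R = (a i + L%:Z)%:~R :> R.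
    by rewrite -[LHS]/((`|(a i + L%:Z)%R|%N)%:~R) abszE ger0_norm//; lia.
  by rewrite rmorphD /= /a rmorphB /= !mxE; ring.
have zoom_close u u' : coord_close d delta u u' ->
    coord_close k.+1 c (zoom l v0 u) (zoom l v0 u').
  move=> uu' i ik; rewrite !mxE.
  have -> : (n i)%:R ^+ l * u 0 i - (v0 i)%:~R - ((n i)%:R ^+ l * u' 0 i - (v0
    i)%:~R)
    = (n i)%:R ^+ l * (u 0 i - u' 0 i) :> R by ring.
  rewrite normrM ger0_norm ?exprn_ge0//; apply: le_trans lc.
  rewrite mulrC; apply: ler_pM => //.
    exact: uu'.
  rewrite lerXn2r ?nnegrE// ler_nat.
  have [->//|ik'] := eqVneq i k; apply/ltnW/n_incr.
  by rewrite ltn_neqAle ik'.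
(* Bootstrap: the part already known to lie in [G] moves by at most [1 / 2], so the next point is
   within 1 of the start and lies in [G] too. *)
have zoom_chain : chain G (coord_close k.+1 h) (zoom l v0 x) (zoom l v0 y).
  elim: xy => [Ex|u u' xu xuG Eu' uu'].
    by apply/chain_nil/zoomG => // i _; rewrite subrr normr0.
  have xu2 := hG _ _ xuG.
  apply: chain_rcons xuG _ (coord_close_le ch (zoom_close _ _ uu')).
  apply: zoomG => //.
  apply: coord_close_le (coord_close_triangle xu2 (zoom_close _ _ uu')); lra.
have := hG _ _ zoom_chain k (leqnn _); rewrite !mxE.
have -> : (n k)%:R ^+ l * x 0 k - (v0 k)%:~R - ((n k)%:R ^+ l * y 0 k - (v0
  k)%:~R)
  = (n k)%:R ^+ l * (x 0 k - y 0 k) :> R by ring.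
rewrite normrM (ger0_norm (ltW nkl0)) => nkxy.
have B0 : 0 <= (B + B)%:R :> R by [].
(* [c < delta * n_k ^ l.+1] turns the bound n_k^-l / 2 into a multiple of [delta]. *)
move: cl; rewrite exprS => cl.
rewrite mulrAC ler_pdivlMr//.
apply: le_trans (ler_wpM2l (normr_ge0 _) (ltW cl)) _.
have -> : `|x 0 k - y 0 k| * (delta * ((n k)%:R * (n k)%:R ^+ l)) =
    (n k)%:R ^+ l * `|x 0 k - y 0 k| * ((n k)%:R * delta) by ring.
apply: (@le_trans _ _ (1 / 2 * ((n k)%:R * delta))).
  by rewrite ler_pM2r// mulr_gt0.
have := mulr_gt0 nk0 delta0; have := mulr_ge0 B0 (ltW delta0); lra.
Qed.

End sponge_dynamics.

(** * Euclidean against coordinatewise distance *)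

Section euclidean.
Variables (R : realType) (d : nat).
Implicit Types (x y : 'rV[R]_d) (E : set 'rV[R]_d).

Lemma coord_le_euclidean x y i : `|x 0 i - y 0 i| <= euclidean_dist x y.
Proof.
rewrite -sqrtr_sqr ler_sqrt; last by apply: sumr_ge0 => j _; exact: sqr_ge0.
by rewrite (bigD1 i)//= lerDl; apply: sumr_ge0 => j _; exact: sqr_ge0.
Qed.

Lemma euclidean_le_sum x y : euclidean_dist x y <= \sum_j `|x 0 j - y 0 j|.
Proof.
have S0 : 0 <= \sum_j `|x 0 j - y 0 j| by exact: sumr_ge0.
rewrite -[leRHS](ger0_norm S0) -sqrtr_sqr ler_sqrt ?sqr_ge0//.
rewrite expr2 mulr_suml; apply: ler_sum => j _.
rewrite -real_normK ?num_real// expr2; apply: ler_wpM2l => //.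
by rewrite (bigD1 j)//= lerDl; exact: sumr_ge0.
Qed.

Lemma close_euclidean h x y : coord_close d h x y ->
  euclidean_dist x y <= d%:R * h.
Proof.
move=> xy; apply: le_trans (euclidean_le_sum x y) _.
rewrite mulr_natl -[X in _ *+ X]card_ord -sumr_const.
by apply: ler_sum => j _; exact: xy.
Qed.

Lemma euclidean_close h x y : euclidean_dist x y <= h -> coord_close d h x y.
Proof. by move=> xy i _; exact: le_trans (coord_le_euclidean x y i) xy. Qed.

Lemma euclidean_le_diam E x y : E x -> E y ->
  ((euclidean_dist x y)%:E <= diam (@euclidean_dist R d) E)%E.
Proof. by move=> Ex Ey; apply: ereal_sup_ubound; exists (x, y). Qed.

(** Coordinatewise steps [h] are Euclidean steps of at most [d%:R * h]; [a] and [b] certify that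
    this is below the diameter. *)
Lemma perfectly_disconnected_close E :
  perfectly_disconnected (@euclidean_dist R d) E ->
  exists2 M, 0 < M & forall h a b, 0 < h -> E a -> E b ->
    d%:R * h < euclidean_dist a b ->
      forall x y, chain E (coord_close d h) x y ->
    forall i, `|x 0 i - y 0 i| <= M * h.
Proof.
(* The summand 1 keeps the constant positive when [d = 0]. *)
move=> [M M0 EM]; exists (M * d%:R + 1).
  by rewrite ltr_wpDl// mulr_ge0// ltW.
move=> h a b h0 Ea Eb hab x y xy i.
have delta0 : 0 < d%:R * h.
  by rewrite mulr_gt0// ltr0n; exact: leq_ltn_trans (leq0n i) (ltn_ord i).
have xyU : delta_equiv (@euclidean_dist R d) E (d%:R * h) x y.
  by apply/delta_equivP; apply: sub_chain xy => u v; exact: close_euclidean.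
have xxU : delta_equiv (@euclidean_dist R d) E (d%:R * h) x x.
  exact/delta_equivP/chain_nil/(chain_src xy).
have := EM _ delta0 _ _ (ex_intro2 _ _ x (chain_src xy) erefl).
move=> /(_ (lt_le_trans _ (euclidean_le_diam Ea Eb))); rewrite lte_fin =>
  /(_ hab).
move=> /(le_trans (euclidean_le_diam (E :=
  [set z | delta_equiv _ E _ x z]) xxU xyU)).
rewrite lee_fin => xyM; apply: le_trans (coord_le_euclidean x y i) _.
by apply: le_trans xyM _; rewrite mulrA ler_pM2r// lerDl.
Qed.

(** The coordinate constants add up, and two points of a component are joined through its base
    point. *)
Lemma close_perfectly_disconnected E :
  (forall i, exists2 M, 0 < M & forall delta, 0 < delta ->
    forall x y, chain E (coord_close d delta) x y ->
      `|x 0 i - y 0 i| <= M * delta) ->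
  perfectly_disconnected (@euclidean_dist R d) E.
Proof.
move=> ex; have [M M0 EM] := all_sig2 (fun i => cid2 (ex i)).
have SM0 : 0 <= \sum_i M i by apply: sumr_ge0 => i _; exact: ltW.
exists (\sum_i M i + 1) => [|delta delta0 _ U [x Ex ->]]; first
  by rewrite ltr_wpDl.
apply: ge_ereal_sup => _ [[u v] [/= /delta_equivP xu /delta_equivP xv] <-].
rewrite lee_fin; apply: le_trans (euclidean_le_sum u v) _.
rewrite mulrDl mul1r; apply: ler_wpDr; first exact: ltW.
rewrite mulr_suml; apply: ler_sum => i _; apply: EM => //.
have toclose w : chain E (fun a b => euclidean_dist a b <= delta) x w ->
    chain E (coord_close d delta) x w.
  by apply: sub_chain => a b; exact: euclidean_close.
apply: chain_trans (toclose _ xv).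
by apply: chain_sym (toclose _ xu) => a b; exact: coord_close_sym.
Qed.

End euclidean.

(** * Total disconnectedness of projections in terms of chains *)

Lemma ball_rowP (R : realType) m (x y : 'rV[R]_m) h : 0 < h ->
  ball x h y <-> forall j, `|x 0 j - y 0 j| < h.
Proof.
move=> h0; split=> [[_ xy] j|xy]; first exact: xy 0 j.
by split=> // i j; rewrite ord1; exact: xy.
Qed.

Section coordinate_map.
Variables (R : realType) (d k : nat) (V : pseudoMetricType R).
Variable (f : 'rV[R]_d -> V).
(** [f] will be a [coord_proj] or, for [k = d], the identity. *)
Hypothesis ball_f : forall x y h, 0 < h -> ball (f x) h (f y) <->
  forall i : 'I_d, (i < k)%N -> `|x 0 i - y 0 i| < h.
Variable E : set 'rV[R]_d.

Let continuous_f : continuous f.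
Proof.
move=> x A /nbhs_ballP[e e0 eA]; apply/nbhs_ballP; exists e => //= y xy.
by apply: eA; apply/ball_f => // i _; move/(ball_rowP _ _ e0): xy; exact.
Qed.

Lemma chain_disconnected_of_totally : compact E ->
  totally_disconnected (f @` E) -> chain_disconnected k E.
Proof.
move=> cE tdE e e0.
have cfE : compact (f @` E).
  by apply: continuous_compact => //; exact: continuous_subspaceT.
have [h h0 fEh] := totally_disconnected_chain cfE tdE e0.
(* Halving turns non-strict closeness into the strict one of balls. *)
exists (h / 2) => [|x y xy i ik]; first by rewrite divr_gt0.
apply/ltW; have /(ball_f _ _ e0) : ball (f x) e (f y); last exact.
apply: fEh; apply: chain_map xy => [u Eu|u v _ _ uv]; first by exists u.
by apply/ball_f => // j jk; apply: le_lt_trans (uv j jk) _; lra.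
Qed.

(** A component is connected, hence chained at every scale; the chain lifts to [E] because
    [coord_close k] sees only what [f] sees. *)
Lemma component_chain a b h : E a -> E b -> 0 < h ->
  connected_component (f @` E) (f a) (f b) -> chain E (coord_close k h) a b.
Proof.
move=> Ea Eb h0 ab; set C := connected_component _ _ in ab.
have Ca : C (f a) by apply: connected_component_refl; exists a.
apply: (@chain_lift _ _ _ f _ (fun u => ball u h)) =>
  // [u|u v /(ball_f _ _ h0) uv i ik|].
- exact: ballxx.
- exact/ltW/uv.
- apply: (@chain_map _ _ _ _ id) (connected_chain _ h0 Ca ab) => // [u Cu|].
    exact: connected_component_sub Cu.
  exact: component_connected.
Qed.


End coordinate_map.

Lemma ball_coord_proj (R : realType) d (j : 'I_d) (x y : 'rV[R]_d) h : 0 < h ->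
  ball (coord_proj j x) h (coord_proj j y) <->
  forall i : 'I_d, (i < j)%N -> `|x 0 i - y 0 i| < h.
Proof.
move=> h0; split=> [/(ball_rowP _ _ h0) xy i ij|xy].
  have := xy (Ordinal ij); rewrite !mxE.
  by rewrite (_ : widen_ord _ _ = i)//; exact: val_inj.
by apply/ball_rowP => // i; rewrite !mxE; apply: xy => /=.
Qed.

Lemma ball_row_id (R : realType) d (x y : 'rV[R]_d) h : 0 < h ->
  ball (id x) h (id y) <-> forall i : 'I_d, (i < d)%N -> `|x 0 i - y 0 i| < h.
Proof.
move=> h0; split=> [/(ball_rowP _ _ h0) xy i _|xy]; first exact: xy.
by apply/ball_rowP => // i; exact: xy.
Qed.

(** * From perfect to total disconnectedness of the sponge and its projections *)

Lemma totally_disconnected_of_component (T : topologicalType) (X : set T) :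
  (forall x y, X x -> connected_component X x y -> y = x) ->
  totally_disconnected X.
Proof.
move=> Xeq x Xx; apply/seteqP; split=> [y /Xeq -> //|y ->].
exact: connected_component_refl.
Qed.

Lemma perfectly_disconnected_totally (R : realType) d (E : set 'rV[R]_d) :
  perfectly_disconnected (@euclidean_dist R d) E -> totally_disconnected E.
Proof.
move=> /perfectly_disconnected_close[M M0 EM].
apply: totally_disconnected_of_component => a b Ea ab.
have Eb : E b := connected_component_sub ab.
apply/rowP => i; apply/eqP/negPn/negP => abi.
have g0 : 0 < `|a 0 i - b 0 i| by rewrite normr_gt0 subr_eq0 eq_sym.
set g := `|_| in g0; have d0 : 0 <= d%:R :> R by [].
have C0 : 0 < M + d%:R + 1 by lra.
(* Both [M * h] and [d%:R * h] are below [g]: the latter makes the step admissible, the former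
   contradicts the resulting bound. *)
pose h := g / (M + d%:R + 1); have h0 : 0 < h by rewrite divr_gt0.
have gh : g = M * h + d%:R * h + h.
  by rewrite -mulrDl -[X in _ + X]mul1r -mulrDl /h mulrC divfK// gt_eqF.
have Mh0 := mulr_gt0 M0 h0; have dh0 := mulr_ge0 d0 (ltW h0).
have hab : d%:R * h < euclidean_dist a b.
  by apply: lt_le_trans (coord_le_euclidean a b i); rewrite -/g; lra.
have ab' : connected_component (id @` E) (id a) (id b) by rewrite image_id.
have := EM _ _ _ h0 Ea Eb hab _ _ (component_chain (@ball_row_id R d) Ea Eb h0
  ab') i.
rewrite -/g; lra.
Qed.

Section sponge_projection.
Variables (R : realType) (d : nat) (n : 'I_d -> nat).
Hypothesis n_ge2 : forall j, (2 <= n j)%N.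
Hypothesis n_incr : forall i j : 'I_d, (i < j)%N -> (n i < n j)%N.
Variables (D : {set digit n}) (E : set 'rV[R]_d).
Hypothesis D_neq0 : D != finset.set0.
Hypothesis spongeE : is_sponge D E.

(* Contracting E by l digits turns a j-close chain into a genuine chain of step
   n_j ^- l, whereas the i-th coordinates of its endpoints are n_i ^- l apart. *)
Lemma sponge_chain_eq (j i : 'I_d) a b :
  perfectly_disconnected (@euclidean_dist R d) E -> E a -> E b ->
  (forall h, 0 < h -> chain E (coord_close j h) a b) -> (i < j)%N ->
  a 0 i = b 0 i.
Proof.
move=> /perfectly_disconnected_close[M M0 EM] Ea Eb ab ij.
apply/eqP/negPn/negP => abi.
have g0 : 0 < `|a 0 i - b 0 i| by rewrite normr_gt0 subr_eq0.
set g := `|_| in g0; have d0 : 0 <= d%:R :> R by [].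
have n_gt0 k : 0 < (n k)%:R :> R by rewrite ltr0n; exact: leq_trans (n_ge2 k).
have [B EB] := sponge_bounded spongeE.
(* 1 serves the coordinates before [j], the two [B] bound a step of [E] in the others. *)
pose C : R := 1 + B%:R + B%:R; have B0 : 0 <= B%:R :> R by [].
have C0 : 0 < C by rewrite /C; lra.
have q1 : 1 < (n j)%:R / (n i)%:R :> R.
  by rewrite ltr_pdivlMr ?n_gt0// mul1r ltr_nat n_incr.
(* As n_j > n_i, a large [l] makes the step C n_j^-l negligible against the separation g n_i^-l. *)
have [l] := expr_archimedean ((M + d%:R) * C / g) q1.
rewrite ltr_pdivrMr// expr_div_n => lC.
have ni0 : 0 < (n i)%:R ^+ l :> R by rewrite exprn_gt0.
have nj0 : 0 < (n j)%:R ^+ l :> R by rewrite exprn_gt0.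
pose h := C / (n j)%:R ^+ l; have h0 : 0 < h by rewrite divr_gt0.
have gh : (M + d%:R) * h < g / (n i)%:R ^+ l.
  rewrite /h mulrA ltr_pdivrMr//; apply: lt_le_trans lC _.
  by rewrite mulrC mulrA mulrAC.
have Mh0 := mulr_gt0 M0 h0; have dh0 := mulr_ge0 d0 (ltW h0).
have hab : d%:R * h < euclidean_dist a b.
  apply: lt_le_trans (coord_le_euclidean a b i); rewrite -/g.
  have : g / (n i)%:R ^+ l <= g.
    rewrite ler_pdivrMr// ler_peMr ?(ltW g0)// exprn_ege1// ler1n.
    exact: leq_trans (n_ge2 i).
  lra.
have [c cE] := sponge_contraction n_ge2 spongeE l D_neq0.
pose S (z : 'rV[R]_d) : 'rV[R]_d := \row_k (z 0 k / (n k)%:R ^+ l + c 0 k).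
have Sdist u v k : `|S u 0 k - S v 0 k| = `|u 0 k - v 0 k| / (n k)%:R ^+ l.
  rewrite !mxE opprD addrACA subrr addr0 -mulrBl normrM normfV.
  by rewrite (ger0_norm (exprn_ge0 _ (ltW (n_gt0 k)))).
have Sab : chain E (coord_close d h) (S a) (S b).
  have nj'0 : 0 < ((n j)%:R ^+ l)^-1 :> R by rewrite invr_gt0.
  apply: chain_map (ab _ nj'0) => // u v Eu Ev uv k _; rewrite Sdist.
  (* Before [j] the given step n_j^-l can only shrink; from [j] on an arbitrary step of [E] is
     divided by n_k^l >= n_j^l. *)
  have [kj|jk] := ltnP k j.
    apply: le_trans (_ : ((n j)%:R ^+ l)^-1 <= _).
      rewrite ler_pdivrMr ?exprn_gt0//; apply: le_trans (uv k kj) _.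
      by rewrite ler_peMr// exprn_ege1// ler1n; exact: leq_trans (n_ge2 k).
    by rewrite /h ler_peMl ?(ltW nj'0)// /C; lra.
  apply: ler_pM => //.
    apply: le_trans (ler_normB _ _) _; have := EB u k Eu; have := EB v k Ev.
    by rewrite /C; lra.
  rewrite lef_pV2 ?posrE ?exprn_gt0// lerXn2r ?nnegrE// ler_nat.
  have [->//|jk'] := eqVneq j k; apply/ltnW/n_incr.
  by rewrite ltn_neqAle jk'.
have := EM _ _ _ h0 Ea Eb hab _ _ Sab i; rewrite Sdist -/g; lra.
Qed.

End sponge_projection.

Theorem theorem1p3 (R : realType) (d : nat) (d_ge2 : (2 <= d)%N)
    (n : 'I_d -> nat) (n_ge2 : forall j : 'I_d, (2 <= n j)%N)
    (n_incr : forall i j : 'I_d, (i < j)%N -> (n i < n j)%N)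
    (D : {set digit n}) (D_neq0 : D != finset.set0)
    (E : set 'rV[R]_d) (spongeE : is_sponge D E)
    (E_nondegenerated : ~ degenerated E) :
  perfectly_disconnected (@euclidean_dist R d) E <->
  totally_disconnected E /\
  (forall j : 'I_d, (0 < j)%N -> totally_disconnected (coord_proj j @` E)).
Proof.
have cE : compact E by case: spongeE.
split=> [pdE|[tdE tdp]].
  split=> [|j j0]; first exact: perfectly_disconnected_totally.
  apply: totally_disconnected_of_component => _ y [a Ea <-] ay.
  have [b Eb by_] := connected_component_sub ay; move: ay; rewrite -by_ => ab.
  apply/rowP => i; rewrite !mxE; apply/esym.
  apply: (sponge_chain_eq n_ge2 n_incr D_neq0 spongeE pdE Ea Eb) => [h h0|];
    last exact: (ltn_ord i).
  exact: (component_chain (@ball_coord_proj R d j) Ea Eb h0 ab).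
apply: close_perfectly_disconnected => k.
apply: (sponge_coord_bound n_ge2 spongeE n_incr).
(* Indices start at 0: coordinate [k] is controlled by the projection to [k.+1] coordinates, which
   for the last [k] is [E] itself. *)
have [kd|dk] := ltnP k.+1 d.
  exact: (chain_disconnected_of_totally
    (@ball_coord_proj R d (Ordinal kd)) cE (tdp (Ordinal kd) isT)).
have -> : k.+1 = d by apply/eqP; rewrite eqn_leq dk andbT.
by apply: (chain_disconnected_of_totally (@ball_row_id R d) cE);
  rewrite image_id.
Qed.
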